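(* Let $S,Y,Z$ be nonempty finite sets and let $p$ be a probability distribution on $S\times Y\times Z$ with full support, i.e. $p_{s,y,z}>0$ for all $(s,y,z)\in S\times Y\times Z$. Let $q$ be an optimal solution of the optimization problem defining $M(p)$, and let $\lambda\in\mathbb{R}^{S\times Y}$, $\mu\in\mathbb{R}^{S\times Z}$ be Lagrange multipliers certifying optimality of $q$. Then: (a) If $q_{s,y,z}>0$ for all $(s,y,z)\in S\times Y\times Z$, then $\mathrm{CI}$, $\mathrm{SI}$, $\mathrm{UIy}$, $\mathrm{UIz}$ are all differentiable in $p$, and for all $(s,y,z)\in S\times Y\times Z$ $$\partial_{s,y,z}\mathrm{CI}(p)=\ln\left(\frac{p_{*,y,z}}{p_{s,y,z}}\right)-\lambda_{s,y}-\mu_{s,z},$$ $$\partial_{s,y,z}\mathrm{SI}(p)=-1+\ln\left(\frac{p_{s,y,*}\,p_{s,*,z}}{p_{s,*,*}\,p_{*,y,*}\,p_{*,*,z}}\right)-\lambda_{s,y}-\mu_{s,z},$$ $$\partial_{s,y,z}\mathrm{UIy}(p)=\ln\left(\frac{p_{*,*,z}}{p_{s,*,z}}\right)+\lambda_{s,y}+\mu_{s,z},$$ $$\partial_{s,y,z}\mathrm{UIz}(p)=\ln\left(\frac{p_{*,y,*}}{p_{s,y,*}}\right)+\lambda_{s,y}+\mu_{s,z}.$$ (b) In any case (i.e. without the positivity assumption of (a)), the vectors in $\mathbb{R}^{S\times Y\times Z}$ defined by $$\mathfrak{g}_{\mathrm{CI}}(p)_{s,y,z}=\ln\left(\frac{p_{*,y,z}}{p_{s,y,z}}\right)-\lambda_{s,y}-\mu_{s,z},\qquad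 \mathfrak{g}_{\mathrm{SI}}(p)_{s,y,z}=-1+\ln\left(\frac{p_{s,y,*}\,p_{s,*,z}}{p_{s,*,*}\,p_{*,y,*}\,p_{*,*,z}}\right)-\lambda_{s,y}-\mu_{s,z}$$ are local super-gradients in the point $p$ of $\mathrm{CI}$ and $\mathrm{SI}$, respectively, and the vectors defined by $$\mathfrak{g}_{\mathrm{UIy}}(p)_{s,y,z}=\ln\left(\frac{p_{*,*,z}}{p_{s,*,z}}\right)+\lambda_{s,y}+\mu_{s,z},\qquad \mathfrak{g}_{\mathrm{UIz}}(p)_{s,y,z}=\ln\left(\frac{p_{*,y,*}}{p_{s,y,*}}\right)+\lambda_{s,y}+\mu_{s,z}$$ are local subgradients in the point $p$ of $\mathrm{UIy}$ and $\mathrm{UIz}$, respectively.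
   Context: Notation: replacing an index by $*$ means summing over all values of that index, e.g. $p_{s,y,*}=\sum_{z\in Z}p_{s,y,z}$, $p_{*,*,z}=\sum_{s\in S,\,y\in Y}p_{s,y,z}$. Entropies. All logarithms are natural and $0\ln 0=0$. For $q\in\mathbb{R}_+^{S\times Y\times Z}$, entropies are those of the corresponding marginals, given by the formula $-\sum x\ln x$ (without normalization): $H(S,Y,Z)=-\sum_{s,y,z}q_{s,y,z}\ln q_{s,y,z}$, $H(Y,Z)=-\sum_{y,z}q_{*,y,z}\ln q_{*,y,z}$, $H(S)=-\sum_s q_{s,*,*}\ln q_{s,*,*}$, and similarly for the other marginals. Conditional entropy, mutual information and co-information are defined from these by $H(A\mid B)=H(A,B)-H(B)$, $\mathrm{MI}(A;B)=H(A)-H(A\mid B)=H(A)+H(B)-H(A,B)$, $\mathrm{MI}(S;Y,Z)=H(S)-H(S\mid Y,Z)$, $\mathrm{MI}(S;Y\mid Z)=H(S\mid Z)-H(S\mid Y,Z)$, $\mathrm{MI}(S;Z\mid Y)=H(S\mid Y)-H(S\mid Y,Z)$, $\mathrm{CoI}(S;Y;Z)=\mathrm{MI}(S;Y)-\mathrm{MI}(S;Y\mid Z)=\mathrm{MI}(S;Y)+\mathrm{MI}(S;Z)-\mathrm{MI}(S;Y,Z)$. A subscript $q$ or $p$ below indicates the vector for which these quantities are evaluated. For $p\in\mathbb{R}_+^{S\times Y\times Z}$ let $\Delta_p$ be the set of all $q\in\mathbb{R}^{S\times Y\times Z}$ with $q_{s,y,*}=p_{s,y,*}$ for all $(s,y)\in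 S\times Y$; $q_{s,*,z}=p_{s,*,z}$ for all $(s,z)\in S\times Z$; and $q_{s,y,z}\ge0$ for all $(s,y,z)$. Define $$M(p):=\max_{q\in\Delta_p}h(q),\qquad h(q)=H_q(S\mid Y,Z)=\sum_{s,y,z}q_{s,y,z}\ln\frac{q_{*,y,z}}{q_{s,y,z}}.$$ The (BROJA) partial information decomposition quantities $\mathrm{CI}$, $\mathrm{SI}$, $\mathrm{UIy}$, $\mathrm{UIz}$ are regarded as functions on $\mathbb{R}_+^{S\times Y\times Z}$, defined for every $p\in\mathbb{R}_+^{S\times Y\times Z}$ (with the unnormalized entropies $-\sum x\ln x$) by $$\mathrm{CI}(p)=\mathrm{MI}_p(S;Y,Z)-\min_{q\in\Delta_p}\mathrm{MI}_q(S;Y,Z),\qquad \mathrm{SI}(p)=\max_{q\in\Delta_p}\mathrm{CoI}_q(S;Y;Z),$$ $$\mathrm{UIy}(p)=\min_{q\in\Delta_p}\mathrm{MI}_q(S;Y\mid Z),\qquad \mathrm{UIz}(p)=\min_{q\in\Delta_p}\mathrm{MI}_q(S;Z\mid Y),$$ and $\partial_{s,y,z}$ denotes the partial derivative with respect to the coordinate $p_{s,y,z}$. For a feasible $q\in\Delta_p$, $\lambda\in\mathbb{R}^{S\times Y}$ and $\mu\in\mathbb{R}^{S\times Z}$ are called Lagrange multipliers certifying optimality (of $q$, for the problem defining $M(p)$) if: (i) for all $(y,z)\in Y\times Z$ with $q_{*,y,z}>0$: $\lambda_{s,y}+\mu_{s,z}=\ln\bigl(q_{s,y,z}/q_{*,y,z}\bigr)$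 for all $s\in S$; (ii) for all $(y,z)\in Y\times Z$ with $q_{*,y,z}=0$ there is a probability distribution $\varrho^{y,z}$ with support $S$ such that $\lambda_{s,y}+\mu_{s,z}\le\ln(\varrho^{y,z}_s)$ for all $s\in S$. Local super-/subgradients: for a real-valued function $f$ defined near $p$ let $f'(p,d)=\lim_{t\downarrow0}\frac{f(p+td)-f(p)}{t}$ be the one-sided directional derivative. A vector $g\in\mathbb{R}^{S\times Y\times Z}$ is a local super-gradient of $f$ in $p$ if $f'(p,d)$ exists and $f'(p,d)\le g^{T}d$ for all $d\in\mathbb{R}^{S\times Y\times Z}$; it is a local subgradient of $f$ in $p$ if $f'(p,d)$ exists and $f'(p,d)\ge g^{T}d$ for all $d\in\mathbb{R}^{S\times Y\times Z}$.
   Formalization: In (a) and (b) the CI formula is corrected to ln(p_{s,y,z}/p_{*,y,z}) − λ_{s,y} − μ_{s,z}; the printed fraction is inverted and false (|S|=2, |Y|=|Z|=1, p uniform: CI is identically 0 but the printed gradient is 2 ln 2). *)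

(* Defs.v *)
From HB Require Import structures.
From mathcomp Require Import all_boot all_order all_algebra.
From mathcomp Require Import all_classical all_reals all_analysis.

Set Implicit Arguments.
Unset Strict Implicit.
Unset Printing Implicit Defensive.

Import Order.TTheory GRing.Theory Num.Theory.
Import numFieldNormedType.Exports.

Local Open Scope classical_set_scope.
Local Open Scope ring_scope.

(* R^(S x Y x Z) is represented by row vectors indexed by an enumeration of
   S * Y * Z, because matrices carry the library's normed-module structure,
   hence its `differentiable` and `'D_v`.  All entries are accessed by [ent]. *)
Notation tensor R S Y Z := 'rV[R]_#|{: S * Y * Z}|.

Definition ent (R : realType) (S Y Z : finType) (q : tensor R S Y Z)
  (s : S) (y : Y) (z : Z) : R := q ord0 (enum_rank (s, y, z)).

Definition basis_vec (R : realType) (S Y Z : finType) (s : S) (y : Y) (z : Z)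
  : tensor R S Y Z := delta_mx ord0 (enum_rank (s, y, z)).

(* Marginals: [mSY q s y] is q_{s,y,*}, and similarly for the others. *)
Definition mSY (R : realType) (S Y Z : finType) (q : tensor R S Y Z)
  (s : S) (y : Y) : R := \sum_(z : Z) ent q s y z.
Definition mSZ (R : realType) (S Y Z : finType) (q : tensor R S Y Z)
  (s : S) (z : Z) : R := \sum_(y : Y) ent q s y z.
Definition mYZ (R : realType) (S Y Z : finType) (q : tensor R S Y Z)
  (y : Y) (z : Z) : R := \sum_(s : S) ent q s y z.
Definition mS (R : realType) (S Y Z : finType) (q : tensor R S Y Z)
  (s : S) : R := \sum_(y : Y) \sum_(z : Z) ent q s y z.
Definition mY (R : realType) (S Y Z : finType) (q : tensor R S Y Z)
  (y : Y) : R := \sum_(s : S) \sum_(z : Z) ent q s y z.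
Definition mZ (R : realType) (S Y Z : finType) (q : tensor R S Y Z)
  (z : Z) : R := \sum_(s : S) \sum_(y : Y) ent q s y z.

Definition entropy (R : realType) (T : finType) (f : T -> R) : R :=
  - \sum_(x : T) f x * ln (f x).

Definition H_SYZ (R : realType) (S Y Z : finType) (q : tensor R S Y Z) : R :=
  entropy (fun x : S * Y * Z => ent q x.1.1 x.1.2 x.2).
Definition H_SY (R : realType) (S Y Z : finType) (q : tensor R S Y Z) : R :=
  entropy (fun x : S * Y => mSY q x.1 x.2).
Definition H_SZ (R : realType) (S Y Z : finType) (q : tensor R S Y Z) : R :=
  entropy (fun x : S * Z => mSZ q x.1 x.2).
Definition H_YZ (R : realType) (S Y Z : finType) (q : tensor R S Y Z) : R :=
  entropy (fun x : Y * Z => mYZ q x.1 x.2).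
Definition H_S (R : realType) (S Y Z : finType) (q : tensor R S Y Z) : R :=
  entropy (mS q).
Definition H_Y (R : realType) (S Y Z : finType) (q : tensor R S Y Z) : R :=
  entropy (mY q).
Definition H_Z (R : realType) (S Y Z : finType) (q : tensor R S Y Z) : R :=
  entropy (mZ q).

(* [H_S_gYZ] is H(S | Y, Z), etc. *)
Definition H_S_gYZ (R : realType) (S Y Z : finType) (q : tensor R S Y Z) : R :=
  H_SYZ q - H_YZ q.
Definition H_S_gY (R : realType) (S Y Z : finType) (q : tensor R S Y Z) : R :=
  H_SY q - H_Y q.
Definition H_S_gZ (R : realType) (S Y Z : finType) (q : tensor R S Y Z) : R :=
  H_SZ q - H_Z q.

Definition MI_S_Y (R : realType) (S Y Z : finType) (q : tensor R S Y Z) : R :=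
  H_S q - H_S_gY q.
Definition MI_S_YZ (R : realType) (S Y Z : finType) (q : tensor R S Y Z) : R :=
  H_S q - H_S_gYZ q.
Definition MI_S_Y_gZ (R : realType) (S Y Z : finType) (q : tensor R S Y Z)
  : R := H_S_gZ q - H_S_gYZ q.
Definition MI_S_Z_gY (R : realType) (S Y Z : finType) (q : tensor R S Y Z)
  : R := H_S_gY q - H_S_gYZ q.
Definition CoI (R : realType) (S Y Z : finType) (q : tensor R S Y Z) : R :=
  MI_S_Y q - MI_S_Y_gZ q.

Definition Delta (R : realType) (S Y Z : finType) (p : tensor R S Y Z)
  : set (tensor R S Y Z) :=
  [set q | [/\ forall s y, mSY q s y = mSY p s y,
               forall s z, mSZ q s z = mSZ p s z &
               forall s y z, 0 <= ent q s y z]].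

(* Maximum and minimum (attained, not merely supremum and infimum) of a real
   function over a set; 0 by convention if there is none.  For p >= 0 the set
   [Delta p] is nonempty and compact and all functions used below are
   continuous on it, so that the default value is never used there. *)
Definition max_over (R : realType) (T : Type) (A : set T) (f : T -> R) : R :=
  xget 0 [set m | (f @` A) m /\ ubound (f @` A) m].
Definition min_over (R : realType) (T : Type) (A : set T) (f : T -> R) : R :=
  xget 0 [set m | (f @` A) m /\ lbound (f @` A) m].

Definition CI (R : realType) (S Y Z : finType) (p : tensor R S Y Z) : R :=
  MI_S_YZ p - min_over (Delta p) (@MI_S_YZ R S Y Z).
Definition SI (R : realType) (S Y Z : finType) (p : tensor R S Y Z) : R :=
  max_over (Delta p) (@CoI R S Y Z).
Definition UIy (R : realType) (S Y Z : finType) (p : tensor R S Y Z) : R :=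
  min_over (Delta p) (@MI_S_Y_gZ R S Y Z).
Definition UIz (R : realType) (S Y Z : finType) (p : tensor R S Y Z) : R :=
  min_over (Delta p) (@MI_S_Z_gY R S Y Z).

(* q is an optimal solution of: maximize H_q(S | Y, Z) over [Delta p]. *)
Definition optimal (R : realType) (S Y Z : finType) (p q : tensor R S Y Z)
  : Prop :=
  Delta p q /\ forall q', Delta p q' -> H_S_gYZ q' <= H_S_gYZ q.

(* In the first clause, ln (q_{s,y,z} / q_{*,y,z}) must be finite, being equal
   to a real number; since the library's [ln] is total with [ln 0 = 0], the
   positivity of q_{s,y,z} has to be stated explicitly. *)
Definition certifies (R : realType) (S Y Z : finType) (q : tensor R S Y Z)
  (lambda : S -> Y -> R) (mu : S -> Z -> R) : Prop :=
  (forall y z, 0 < mYZ q y z ->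
     forall s, 0 < ent q s y z /\
               lambda s y + mu s z = ln (ent q s y z / mYZ q y z)) /\
  (forall y z, mYZ q y z = 0 ->
     exists rho : S -> R,
       [/\ forall s, 0 < rho s,
           \sum_(s : S) rho s = 1 &
           forall s, lambda s y + mu s z <= ln (rho s)]).

Definition dotp (R : realType) (S Y Z : finType) (g : S -> Y -> Z -> R)
  (d : tensor R S Y Z) : R :=
  \sum_(s : S) \sum_(y : Y) \sum_(z : Z) g s y z * ent d s y z.

Definition is_dir_derivative (R : realType) (S Y Z : finType)
  (f : tensor R S Y Z -> R) (p d : tensor R S Y Z) (l : R) : Prop :=
  (fun t : R => (f (p + t *: d) - f p) / t) @ 0^'+ --> l.

Definition local_supergradient (R : realType) (S Y Z : finType)
  (f : tensor R S Y Z -> R) (p : tensor R S Y Z) (g : S -> Y -> Z -> R)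
  : Prop :=
  forall d, exists2 l, is_dir_derivative f p d l & l <= dotp g d.
Definition local_subgradient (R : realType) (S Y Z : finType)
  (f : tensor R S Y Z -> R) (p : tensor R S Y Z) (g : S -> Y -> Z -> R)
  : Prop :=
  forall d, exists2 l, is_dir_derivative f p d l & dotp g d <= l.

(* CI(p) = M(p) - H_p(S | Y, Z), where M(p) is the maximum of H_q(S | Y, Z)
   over [Delta p]; the partial derivatives of the subtracted term are
   ln (p_{*,y,z} / p_{s,y,z}), whence the orientation of the fraction. *)
Definition g_CI (R : realType) (S Y Z : finType) (p : tensor R S Y Z)
  (lambda : S -> Y -> R) (mu : S -> Z -> R) (s : S) (y : Y) (z : Z) : R :=
  ln (ent p s y z / mYZ p y z) - lambda s y - mu s z.
Definition g_SI (R : realType) (S Y Z : finType) (p : tensor R S Y Z)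
  (lambda : S -> Y -> R) (mu : S -> Z -> R) (s : S) (y : Y) (z : Z) : R :=
  - 1 + ln ((mSY p s y * mSZ p s z) / (mS p s * mY p y * mZ p z))
  - lambda s y - mu s z.
Definition g_UIy (R : realType) (S Y Z : finType) (p : tensor R S Y Z)
  (lambda : S -> Y -> R) (mu : S -> Z -> R) (s : S) (y : Y) (z : Z) : R :=
  ln (mZ p z / mSZ p s z) + lambda s y + mu s z.
Definition g_UIz (R : realType) (S Y Z : finType) (p : tensor R S Y Z)
  (lambda : S -> Y -> R) (mu : S -> Z -> R) (s : S) (y : Y) (z : Z) : R :=
  ln (mY p y / mSY p s y) + lambda s y + mu s z.

(* Differentiability is total (Frechet); the partial derivatives are the
   directional derivatives along the standard basis vectors. *)
Definition differentiable_with_partials (R : realType) (S Y Z : finType)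
  (f : tensor R S Y Z -> R) (p : tensor R S Y Z) (g : S -> Y -> Z -> R)
  : Prop :=
  differentiable f p /\ forall s y z, 'D_(basis_vec R s y z) f p = g s y z.

(* Main.v *)
Require Import Defs.
From mathcomp Require Import all_boot all_order all_algebra.
From mathcomp Require Import all_classical all_reals all_analysis.
From mathcomp Require Import ring lra.
Import Order.TTheory GRing.Theory Num.Theory.
Import numFieldNormedType.Exports.
Local Open Scope classical_set_scope.
Local Open Scope ring_scope.

(** Write [M p] for the maximum of [H_q(S | Y, Z)] over [q] in [Delta p]
    ([max_cond] below).  On [Delta p] the entropies of S, Y, Z, (S, Y) and
    (S, Z) are constant, so that near a strictly positive [p] each of CI, SI,
    UIy, UIz is a differentiable combination of entropies of marginals of [p],
    plus or minus [M p] ([CI_max_cond], [SI_max_cond], [UIy_max_cond],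
    [UIz_max_cond]).  Everything therefore reduces to [M].

    Let [G = - (lambda + mu)].  The multipliers and the inequality of Gibbs
    give [H_q'(S | Y, Z) <= <G, q'>] for every nonnegative [q'], with equality
    at [q].  Since [<G, q'>] only involves the (S, Y)- and (S, Z)-marginals, it
    is constant on every [Delta p'], whence [M p' <= <G, p'>] for all
    nonnegative [p'], with equality at [p] ([max_cond_le_multipliers],
    [max_cond_multipliers]).

    If [q] is strictly positive, then [q + (p' - p)] belongs to [Delta p'] for
    [p'] near [p], so that [M p'] also lies above the conditional entropy of
    [q + (p' - p)].  This function of [p'] takes the same value at [p] and its
    gradient there is [G]; squeezed between the two, [M] is differentiable at
    [p] with gradient [G] ([is_diff_max_cond]).

    In general, conditional entropy is concave (again by Gibbs), hence so is
    [M]; its difference quotients along a ray from [p] are monotone and bounded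
    by [<G, d>], and thus converge to a limit at most [<G, d>]
    ([supergradient_max_cond]).

    That the maximum defining [M] is attained rests on the compactness of
    [Delta p] and on the continuity of [x ln x], including at 0. *)

Set Implicit Arguments.
Unset Strict Implicit.
Unset Printing Implicit Defensive.

(** * The inequality of Gibbs *)

Lemma lnM_le_sub (R : realType) (x y : R) :
  0 < x -> 0 < y -> x * (ln y - ln x) <= y - x.
Proof.
move=> x0 y0; rewrite -ln_div ?posrE//.
have yx0 : 0 < y / x by rewrite divr_gt0.
have := @le_ln1Dx R (y / x - 1).
rewrite ltrBrDl addrN subrKC => /(_ yx0) h.
rewrite -(ler_pM2l x0) in h; rewrite (le_trans h)//.
by rewrite mulrBr mulr1 mulrCA divff ?gt_eqF// mulr1.
Qed.

(** Gibbs' inequality for an unnormalized [x]: entropy relative to the total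
    mass is at most the cross entropy with a sub-distribution [rho].  Taking a
    lower bound [L] of [ln rho] on the support of [x] lets multipliers
    be used directly. *)
Lemma gibbs (R : realType) (S : finType) (x rho L : S -> R) :
  (forall s, 0 <= x s) -> (forall s, 0 <= rho s) -> \sum_s rho s <= 1 ->
  (forall s, 0 < x s -> 0 < rho s /\ L s <= ln (rho s)) ->
  (\sum_s x s) * ln (\sum_s x s) - \sum_s x s * ln (x s)
    <= - \sum_s L s * x s.
Proof.
move=> x0 r0 r1 xL; set X := \sum_s x s.
have X0 : 0 <= X by rewrite sumr_ge0.
rewrite -subr_le0 opprK.
rewrite [X in X <= _](_ : _ = \sum_s x s * (ln X + L s - ln (x s))); last first.
  rewrite {1}/X mulr_suml -sumrB -big_split/=.
  by apply: eq_bigr => s _; ring.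
(* Each term is at most [X * rho s - x s], by [ln t <= t - 1] at
   [t = X * rho s / x s], and these bounds sum to a nonpositive number. *)
have : \sum_s (X * rho s - x s) <= 0.
  by rewrite sumrB -mulr_sumr subr_le0 ler_piMr.
apply: le_trans; apply: ler_sum => s _.
have := x0 s; rewrite le_eqVlt => /predU1P[<-|xs].
  by rewrite mul0r subr0 mulr_ge0.
have [rs Ls] := xL _ xs.
have Xgt : 0 < X.
  by rewrite (lt_le_trans xs)// /X (bigD1 s)//= lerDl sumr_ge0.
apply: le_trans (lnM_le_sub xs (mulr_gt0 Xgt rs)).
by rewrite ler_pM2l// lnM ?posrE// lerB// lerD2l.
Qed.

(** The case of equality: [rho] is [x] normalized; all terms vanish when the
    total mass is 0. *)
Lemma gibbs_eq (R : realType) (S : finType) (x : S -> R) :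
  (forall s, 0 <= x s) ->
  (\sum_s x s) * ln (\sum_s x s) - \sum_s x s * ln (x s)
    = - \sum_s ln (x s / \sum_s x s) * x s.
Proof.
move=> x0; set X := \sum_s x s.
rewrite {1}/X mulr_suml -sumrB -sumrN; apply: eq_bigr => s _.
have := x0 s; rewrite le_eqVlt => /predU1P[<-|xs].
  by rewrite !mul0r mulr0; ring.
have Xgt : 0 < X.
  by rewrite (lt_le_trans xs)// /X (bigD1 s)//= lerDl sumr_ge0.
by rewrite ln_div ?posrE//; ring.
Qed.

Lemma sum_fin_gt0 (R : realType) (T : finType) (f : T -> R) :
  (0 < #|T|)%N -> (forall x, 0 < f x) -> 0 < \sum_x f x.
Proof.
move=> /card_gt0P[x _] f0; rewrite (bigD1 x)//= ltr_pwDl//.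
by apply: sumr_ge0 => y _; exact/ltW.
Qed.

(** * First-order expansions of real functions on a normed space *)

Lemma is_diff_le (R : realType) (V : normedModType R) (f df : V -> R) (p : V) :
  is_diff p f df -> forall e, 0 < e ->
  \forall h \near 0, `|f (h + p) - f p - df h| <= e * `|h|.
Proof.
move=> dfp e e0.
have dp : differentiable f p by exact: ex_diff.
have /eqaddoP/(_ e e0) := diff_locally dp.
rewrite (diff_val (f := f)).
apply: filterS => h /=.
by rewrite -[(_ - _) h]/(f (h + p) - (f p + df h)) opprD addrA.
Qed.

Lemma is_diff_of_le (R : realType) (V : normedModType R) (f : V -> R)
    (df : {linear V -> R}) (p : V) : continuous df ->
  (forall e, 0 < e ->
    \forall h \near 0, `|f (h + p) - f p - df h| <= e * `|h|) ->
  is_diff p f df.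
Proof.
move=> cdf H.
have E : f \o shift p = cst (f p) + df +o_ 0 id.
  apply/eqaddoP => e e0; apply: filterS (H e e0) => h.
  by rewrite -[X in `|X| <= _ -> _]addrA -opprD.
have D : 'd f p = df :> (V -> R) by exact: diff_unique.
by apply: DiffDef => //; apply/diff_locallyP; rewrite D.
Qed.

(** Two functions with the same value and differential at [p] force them on
    any function lying between them near [p]. *)
Lemma is_diff_squeeze (R : realType) (V : normedModType R) (f l u df : V -> R)
    (p : V) :
  is_diff p l df -> is_diff p u df -> l p = f p -> u p = f p ->
  (\forall q \near p, l q <= f q <= u q) -> is_diff p f df.
Proof.
move=> dl du lp up lfu.
have udf : 'd u p = df :> (V -> R) by exact: diff_val.
have cu : continuous ('d u p) by apply: diff_continuous.
rewrite -udf; apply: is_diff_of_le => // e e0; rewrite udf.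
have := lfu; rewrite (near_shift 0)/= => lfu0.
near=> h.
have : `|u (h + p) - u p - df h| <= e * `|h| by near: h; exact: is_diff_le.
have : `|l (h + p) - l p - df h| <= e * `|h| by near: h; exact: is_diff_le.
have : l (h + p) <= f (h + p) <= u (h + p).
  have -> : h + p = shift (p - 0) h by rewrite subr0.
  by near: h; exact: lfu0.
rewrite up lp !ler_norml => /andP[? ?] /andP[? ?] /andP[? ?].
by apply/andP; split; lra.
Unshelve. all: by end_near. Qed.

Lemma is_diff_near_eq (R : realType) (V : normedModType R) (f g df : V -> R)
    (p : V) :
  (\forall q \near p, f q = g q) -> is_diff p f df -> is_diff p g df.
Proof.
move=> fg dfp; have fgp := nbhs_singleton fg.
apply: (is_diff_squeeze dfp dfp) => //.
by apply: filterS fg => q ->; rewrite lexx.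
Qed.

Lemma is_diff_bigsum (R : realType) (V : normedModType R) (I : finType)
    (f df : I -> V -> R) (p : V) :
  (forall i, is_diff p (f i) (df i)) ->
  is_diff p (fun x => \sum_i f i x) (fun x => \sum_i df i x).
Proof.
move=> fdf.
rewrite (_ : (fun x => _) = \sum_i f i); last first.
  by apply/funext => x; rewrite fct_sumE.
rewrite [X in is_diff _ _ X](_ : _ = \sum_i df i); last first.
  by apply/funext => x; rewrite fct_sumE.
by apply: (@big_ind2 _ _ (fun a b => is_diff p a b)) => //;
  [exact: is_diff_cst | move=> *; exact: is_diffD].
Qed.

Lemma is_diff_xlnx (R : realType) (a : R) : 0 < a ->
  is_diff a (fun x : R => x * ln x) (fun h => (1 + ln a) * h).
Proof.
move=> a0.
have dln : is_diff a (@ln R) (fun h => a^-1 * h).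
  have [ld lE] := @is_derive1_ln R a a0.
  have ld' : differentiable (@ln R) a by apply/derivable1_diffP.
  apply: DiffDef => //; apply/funext => h.
  rewrite -[h in LHS]mulr1 linearZ/= -deriveE// lE.
  exact: mulrC.
apply: (is_diff_eq (is_diffM (is_diff_id a) dln)).
apply/funext => h.
by rewrite -[LHS]/(a * (a^-1 * h) + ln a * h) mulrA divff ?gt_eqF// mulrDl.
Qed.

(** A Frechet differential gives the one-sided directional derivatives. *)
Lemma is_diff_dir (R : realType) (V : normedModType R) (f df : V -> R)
    (p d : V) :
  is_diff p f df -> (f (p + t *: d) - f p) / t @[t --> 0^'+] --> df d.
Proof.
move=> dfp; have dp : differentiable f p by exact: ex_diff.
have h : (fun h : R => h^-1 *: ((f \o shift p) (h *: d) - f p)) @ 0^'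
    --> 'D_d f p by exact: diff_derivable.
have <- : 'D_d f p = df d by rewrite deriveE// (diff_val (f := f)).
move=> A /h /nbhs_ballP [_ /posnumP[e] he].
exists e%:num => //= t te t0.
have := he t te (lt0r_neq0 t0).
by rewrite /= /GRing.scale/= mulrC [_ + p]addrC.
Qed.

Lemma is_diff_entropy (R : realType) (V : normedModType R) (T : finType)
    (m : V -> T -> R) (p : V) :
  (forall x, is_diff p (m ^~ x) (m ^~ x)) -> (forall x, 0 < m p x) ->
  is_diff p (fun v => entropy (m v))
    (fun d => - \sum_x (1 + ln (m p x)) * m d x).
Proof.
move=> dm m0; apply: is_diffN; apply: is_diff_bigsum => x.
exact: (is_diff_comp (dm x) (is_diff_xlnx (m0 x))).
Qed.

(** * Continuity of entropy *)

Lemma continuous_xlnx (R : realType) : continuous (fun x : R => x * ln x).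
Proof.
move=> x; have [x0|x0|->] := ltgtP x 0.
- rewrite /continuous_at (ln0 (ltW x0)) mulr0.
  apply: cvg_near_cst; near=> y.
  by rewrite ln0 ?mulr0// ltW//; near: y; exact: lt_nbhsl.
- apply: cvgM; [exact: cvg_id | exact: continuous_ln].
- rewrite /continuous_at mul0r; apply/cvgrPdist_lt => e e0.
  near=> y; rewrite sub0r normrN.
  have [y0|y0] := leP y 0; first by rewrite ln0// mulr0 normr0.
  (* With [r = sqrt y], [ln (1 / r) < 1 / r] gives [|y ln y| < 2 r]. *)
  have ylt : y < (e / 2) ^+ 2.
    by near: y; apply: lt_nbhsl; rewrite exprn_gt0// divr_gt0.
  have y1 : y < 1 by near: y; apply: lt_nbhsl.
  set r := Num.sqrt y.
  have r0 : 0 < r by rewrite sqrtr_gt0.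
  have yE : y = r * r by rewrite -expr2 sqr_sqrtr// ltW.
  have re : r < e / 2.
    by rewrite -(ltr_pXn2r (n := 2))// ?nnegrE ?ltW ?divr_gt0// sqr_sqrtr// ltW.
  have lr : ln y = ln r + ln r by rewrite yE lnM ?posrE.
  have lny : ln y < 0 by rewrite ln_lt0// y0 y1.
  have := @ln_sublinear R r^-1; rewrite invr_gt0 lnV ?posrE// => /(_ r0) h.
  rewrite -(ltr_pM2l r0) divff ?gt_eqF// in h.
  rewrite ltr0_norm; last by rewrite nmulr_llt0.
  have : r * (r * - ln r) < r * 1 by rewrite ltr_pM2l.
  rewrite lr {1}yE; lra.
Unshelve. all: by end_near. Qed.

Lemma continuous_entropy (R : realType) (V : topologicalType) (T : finType)
    (m : V -> T -> R) :
  (forall x, continuous (m ^~ x)) -> continuous (fun v => entropy (m v)).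
Proof.
move=> mc v; rewrite /entropy; apply: cvgN.
apply: cvg_big => [|x _]; first exact: add_continuous.
exact: (@continuous_comp _ _ _ (m ^~ x) (fun x : R => x * ln x) _ (mc x v)
  (@continuous_xlnx R (m v x))).
Qed.

(** * Attained extrema *)

Lemma max_over_eq (R : realType) (T : Type) (A : set T) (f : T -> R) a :
  A a -> (forall b, A b -> f b <= f a) -> max_over A f = f a.
Proof.
move=> Aa fa; rewrite /max_over; apply: xget_unique.
  by split; [exists a | move=> _ [b Ab <-]; exact: fa].
by move=> y [[b Ab <-] ub]; apply/eqP; rewrite eq_le fa//= ub//; exists a.
Qed.

Lemma min_over_eq (R : realType) (T : Type) (A : set T) (f : T -> R) a :
  A a -> (forall b, A b -> f a <= f b) -> min_over A f = f a.
Proof.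
move=> Aa fa; rewrite /min_over; apply: xget_unique.
  by split; [exists a | move=> _ [b Ab <-]; exact: fa].
by move=> y [[b Ab <-] ub]; apply/eqP; rewrite eq_le fa// andbT ub//; exists a.
Qed.

Section tensors.
Context {R : realType} {S Y Z : finType}.
Implicit Types (p q d : tensor R S Y Z) (g : S -> Y -> Z -> R).

(** * Linear functionals on tensors *)

Lemma entD p q s y z : ent (p + q) s y z = ent p s y z + ent q s y z.
Proof. by rewrite /ent mxE. Qed.
Lemma entN p s y z : ent (- p) s y z = - ent p s y z.
Proof. by rewrite /ent mxE. Qed.
Lemma entZ (a : R) p s y z : ent (a *: p) s y z = a * ent p s y z.
Proof. by rewrite /ent mxE. Qed.

Lemma ent_basis_vec (s s' : S) (y y' : Y) (z z' : Z) :
  ent (basis_vec R s y z) s' y' z' = ((s', y', z') == (s, y, z))%:R.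
Proof. by rewrite /ent mxE eqxx/= (inj_eq enum_rank_inj). Qed.

Lemma dotpDl g g' d :
  dotp (fun s y z => g s y z + g' s y z) d = dotp g d + dotp g' d.
Proof.
rewrite /dotp -big_split; apply: eq_bigr => s _.
rewrite -big_split; apply: eq_bigr => y _.
by rewrite -big_split; apply: eq_bigr => z _; rewrite mulrDl.
Qed.

Lemma dotpNl g d : dotp (fun s y z => - g s y z) d = - dotp g d.
Proof.
rewrite /dotp -sumrN; apply: eq_bigr => s _.
rewrite -sumrN; apply: eq_bigr => y _.
by rewrite -sumrN; apply: eq_bigr => z _; rewrite mulNr.
Qed.

Lemma dotpDr g d d' : dotp g (d + d') = dotp g d + dotp g d'.
Proof.
rewrite /dotp -big_split; apply: eq_bigr => s _.
rewrite -big_split; apply: eq_bigr => y _.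
by rewrite -big_split; apply: eq_bigr => z _; rewrite entD mulrDr.
Qed.

Lemma dotpZr (a : R) g d : dotp g (a *: d) = a * dotp g d.
Proof.
rewrite /dotp mulr_sumr; apply: eq_bigr => s _.
rewrite mulr_sumr; apply: eq_bigr => y _.
by rewrite mulr_sumr; apply: eq_bigr => z _; rewrite entZ mulrCA.
Qed.

Lemma eq_dotp g g' d : (forall s y z, g s y z = g' s y z) ->
  dotp g d = dotp g' d.
Proof.
by move=> gg'; do 3 (apply: eq_bigr => ? _); rewrite gg'.
Qed.

Lemma dotp_basis_vec g s y z : dotp g (basis_vec R s y z) = g s y z.
Proof.
rewrite /dotp (bigD1 s)//= (bigD1 y)//= (bigD1 z)//= ent_basis_vec eqxx mulr1.
rewrite !big1 ?addr0// => [s' ns|y' ny|z' nz].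
- rewrite big1// => y' _; rewrite big1// => z' _.
  by rewrite ent_basis_vec !xpair_eqE (negbTE ns) mulr0.
- rewrite big1// => z' _.
  by rewrite ent_basis_vec !xpair_eqE (negbTE ny) andbF mulr0.
- by rewrite ent_basis_vec !xpair_eqE (negbTE nz) andbF mulr0.
Qed.

Lemma dotp_YZS g d :
  dotp g d = \sum_y \sum_z \sum_s g s y z * ent d s y z.
Proof.
rewrite /dotp exchange_big/=; apply: eq_bigr => y _.
by rewrite exchange_big.
Qed.

Lemma dotp_SYZ g d :
  \sum_(x : S * Y * Z) g x.1.1 x.1.2 x.2 * ent d x.1.1 x.1.2 x.2 = dotp g d.
Proof.
by rewrite /dotp pair_big pair_big/=; apply: eq_bigr => -[[s y] z] _.
Qed.

(** The next lemmas write a linear functional that factors through a marginal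
    as a scalar product with a tensor that is constant in the summed indices. *)
Lemma dotp_SY (c : S -> Y -> R) d :
  \sum_(x : S * Y) c x.1 x.2 * mSY d x.1 x.2 = dotp (fun s y _ => c s y) d.
Proof.
rewrite /dotp pair_big/=; apply: eq_bigr => -[s y] _ /=.
by rewrite /mSY mulr_sumr.
Qed.

Lemma dotp_SZ (c : S -> Z -> R) d :
  \sum_(x : S * Z) c x.1 x.2 * mSZ d x.1 x.2 = dotp (fun s _ z => c s z) d.
Proof.
rewrite /dotp; under [RHS]eq_bigr do rewrite exchange_big/=.
rewrite pair_big/=; apply: eq_bigr => -[s z] _ /=.
by rewrite /mSZ mulr_sumr.
Qed.

Lemma dotp_YZ (c : Y -> Z -> R) d :
  \sum_(x : Y * Z) c x.1 x.2 * mYZ d x.1 x.2 = dotp (fun _ y z => c y z) d.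
Proof.
rewrite dotp_YZS pair_big/=; apply: eq_bigr => -[y z] _ /=.
by rewrite /mYZ mulr_sumr.
Qed.

Lemma dotp_S (c : S -> R) d : \sum_s c s * mS d s = dotp (fun s _ _ => c s) d.
Proof.
apply: eq_bigr => s _; rewrite /mS mulr_sumr.
by apply: eq_bigr => y _; rewrite mulr_sumr.
Qed.

Lemma dotp_Y (c : Y -> R) d : \sum_y c y * mY d y = dotp (fun _ y _ => c y) d.
Proof.
rewrite /dotp exchange_big/=; apply: eq_bigr => y _; rewrite /mY mulr_sumr.
by apply: eq_bigr => s _; rewrite mulr_sumr.
Qed.

Lemma dotp_Z (c : Z -> R) d : \sum_z c z * mZ d z = dotp (fun _ _ z => c z) d.
Proof.
rewrite /dotp; under [RHS]eq_bigr do rewrite exchange_big/=.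
rewrite exchange_big/=; apply: eq_bigr => z _; rewrite /mZ mulr_sumr.
by apply: eq_bigr => s _; rewrite mulr_sumr.
Qed.

(** Coordinatewise nonnegative tensors, the domain of the decomposition. *)
Definition nonneg p := forall s y z, 0 <= ent p s y z.

Lemma cvg_line p d : (p + t *: d) @[t --> (0 : R)^'+] --> p.
Proof.
apply: cvg_at_right_filter.
have h : {for (0 : R), continuous (fun t : R => p + t *: d)}.
  apply: continuousD; first exact: cst_continuous.
  exact: (@scalel_continuous R _ d 0).
have {}h : (p + t *: d) @[t --> (0 : R)] --> p + 0 *: d by exact: h.
by rewrite scale0r addr0 in h.
Qed.

(** * Conditional entropy *)

(** H(S | Y, Z) splits into a sum of entropies, relative to their mass, of the
    slices [q _ y z]. *)
Lemma H_S_gYZ_slices q :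
  H_S_gYZ q = \sum_y \sum_z (mYZ q y z * ln (mYZ q y z)
                             - \sum_s ent q s y z * ln (ent q s y z)).
Proof.
rewrite /H_S_gYZ /H_SYZ /H_YZ /entropy opprK addrC.
under [RHS]eq_bigr do rewrite sumrB.
rewrite sumrB; congr (_ - _); first by rewrite pair_big.
transitivity (dotp (fun s y z => ln (ent q s y z)) q).
  by rewrite -dotp_SYZ; apply: eq_bigr => x _; rewrite mulrC.
rewrite dotp_YZS; apply: eq_bigr => y _; apply: eq_bigr => z _.
by apply: eq_bigr => s _; rewrite mulrC.
Qed.

Lemma H_S_gYZ_le_dotp (L : S -> Y -> Z -> R) q :
  nonneg q ->
  (forall y z, exists rho : S -> R, [/\ forall s, 0 <= rho s,
     \sum_s rho s <= 1 &
     forall s, 0 < ent q s y z -> 0 < rho s /\ L s y z <= ln (rho s)]) ->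
  H_S_gYZ q <= - dotp L q.
Proof.
move=> q0 hL; rewrite H_S_gYZ_slices dotp_YZS -sumrN; apply: ler_sum => y _.
rewrite -sumrN; apply: ler_sum => z _.
have [rho [r0 r1 rL]] := hL y z.
exact: (gibbs (rho := rho)).
Qed.

Lemma H_S_gYZ_eq_dotp q : nonneg q ->
  H_S_gYZ q = - dotp (fun s y z => ln (ent q s y z / mYZ q y z)) q.
Proof.
move=> q0; rewrite H_S_gYZ_slices dotp_YZS -sumrN; apply: eq_bigr => y _.
by rewrite -sumrN; apply: eq_bigr => z _; rewrite gibbs_eq.
Qed.

Lemma mYZ_ge0 q y z : nonneg q -> 0 <= mYZ q y z.
Proof. by move=> q0; exact: sumr_ge0. Qed.

Lemma mYZ_gt0 q s y z : nonneg q ->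
  0 < ent q s y z -> 0 < mYZ q y z.
Proof.
move=> q0 qs; rewrite (lt_le_trans qs)// /mYZ (bigD1 s)//= lerDl.
exact: sumr_ge0.
Qed.

(** The sum is 1, except when [mYZ q y z = 0], where division by 0 makes
    it 0. *)
Lemma sum_cond_le1 q y z : nonneg q ->
  \sum_s ent q s y z / mYZ q y z <= 1.
Proof.
move=> q0; rewrite -mulr_suml -/(mYZ q y z).
have [->|n0] := eqVneq (mYZ q y z) 0; first by rewrite mul0r ler01.
by rewrite divff.
Qed.

(** For [b = 1 - a] this is concavity.  The cross entropy relative to the
    conditional distribution of the combined tensor is linear, is exact at the
    combined tensor, and bounds both terms from above. *)
Lemma H_S_gYZ_superadditive (a b : R) p q : 0 < a -> 0 < b ->
  nonneg p -> nonneg q ->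
  a * H_S_gYZ p + b * H_S_gYZ q <= H_S_gYZ (a *: p + b *: q).
Proof.
move=> a0 b0 p0 q0; set r := a *: p + b *: q.
have rE s y z : ent r s y z = a * ent p s y z + b * ent q s y z.
  by rewrite /r entD !entZ.
have r0 s y z : 0 <= ent r s y z.
  by rewrite rE addr_ge0// mulr_ge0// ltW.
rewrite [leRHS]H_S_gYZ_eq_dotp// {3}/r dotpDr !dotpZr opprD -!mulrN.
apply: lerD; rewrite ler_pM2l//; apply: H_S_gYZ_le_dotp => // y z;
  exists (fun s => ent r s y z / mYZ r y z); split;
  do ?[by move=> s; rewrite divr_ge0// mYZ_ge0]; do ?[exact: sum_cond_le1];
  move=> s es; split=> //; suff rs : 0 < ent r s y z by
    rewrite divr_gt0// (mYZ_gt0 r0 rs).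
- by rewrite rE ltr_wpDr// ?mulr_gt0// mulr_ge0// ltW.
- by rewrite rE ltr_wpDl// ?mulr_gt0// mulr_ge0// ltW.
Qed.

(** * Differentiation of marginals and their entropies *)

Lemma is_diff_ent p s y z :
  is_diff p (fun q => ent q s y z) (fun d => ent d s y z).
Proof.
have @f : {linear tensor R S Y Z -> R}.
  by exists (fun q => ent q s y z); do 2![eexists]; do ?[constructor];
     rewrite /ent ?mxE// => ? *; rewrite ?mxE//; move=> ?; rewrite !mxE.
have cf : continuous f by exact: coord_continuous.
have fE : (fun q => ent q s y z) = f by [].
rewrite fE; apply: DiffDef; first exact: linear_differentiable.
exact: (diff_lin _ cf).
Qed.

Lemma is_diff_mSY p s y : is_diff p (fun q => mSY q s y) (fun q => mSY q s y).
Proof. by apply: is_diff_bigsum => z; exact: is_diff_ent. Qed.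
Lemma is_diff_mSZ p s z : is_diff p (fun q => mSZ q s z) (fun q => mSZ q s z).
Proof. by apply: is_diff_bigsum => y; exact: is_diff_ent. Qed.
Lemma is_diff_mYZ p y z : is_diff p (fun q => mYZ q y z) (fun q => mYZ q y z).
Proof. by apply: is_diff_bigsum => s; exact: is_diff_ent. Qed.
Lemma is_diff_mS p s : is_diff p (fun q => mS q s) (fun q => mS q s).
Proof. by apply: is_diff_bigsum => y; exact: is_diff_mSY. Qed.
Lemma is_diff_mY p y : is_diff p (fun q => mY q y) (fun q => mY q y).
Proof. by apply: is_diff_bigsum => s; exact: is_diff_mSY. Qed.
Lemma is_diff_mZ p z : is_diff p (fun q => mZ q z) (fun q => mZ q z).
Proof. by apply: is_diff_bigsum => s; exact: is_diff_mSZ. Qed.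

Lemma is_diff_dotp p g : is_diff p (dotp g) (dotp g).
Proof.
apply: is_diff_bigsum => s; apply: is_diff_bigsum => y.
apply: is_diff_bigsum => z.
exact: (is_diffZ (g s y z) (is_diff_ent p s y z)).
Qed.

Lemma is_diff_H_SYZ p : (forall s y z, 0 < ent p s y z) ->
  is_diff p (@H_SYZ R S Y Z) (dotp (fun s y z => - (1 + ln (ent p s y z)))).
Proof.
move=> p0; apply: (is_diff_eq (is_diff_entropy
  (m := fun p (x : S * Y * Z) => ent p x.1.1 x.1.2 x.2) _ _)).
- by move=> x; exact: is_diff_ent.
- by [].
- by apply/funext => d; rewrite dotpNl -dotp_SYZ.
Qed.

Lemma is_diff_H_SY p : (forall s y, 0 < mSY p s y) ->
  is_diff p (@H_SY R S Y Z) (dotp (fun s y _ => - (1 + ln (mSY p s y)))).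
Proof.
move=> p0; apply: (is_diff_eq (is_diff_entropy
  (m := fun p (x : S * Y) => mSY p x.1 x.2) _ _)).
- by move=> x; exact: is_diff_mSY.
- by [].
- by apply/funext => d; rewrite dotpNl -dotp_SY.
Qed.

Lemma is_diff_H_SZ p : (forall s z, 0 < mSZ p s z) ->
  is_diff p (@H_SZ R S Y Z) (dotp (fun s _ z => - (1 + ln (mSZ p s z)))).
Proof.
move=> p0; apply: (is_diff_eq (is_diff_entropy
  (m := fun p (x : S * Z) => mSZ p x.1 x.2) _ _)).
- by move=> x; exact: is_diff_mSZ.
- by [].
- by apply/funext => d; rewrite dotpNl -dotp_SZ.
Qed.

Lemma is_diff_H_YZ p : (forall y z, 0 < mYZ p y z) ->
  is_diff p (@H_YZ R S Y Z) (dotp (fun _ y z => - (1 + ln (mYZ p y z)))).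
Proof.
move=> p0; apply: (is_diff_eq (is_diff_entropy
  (m := fun p (x : Y * Z) => mYZ p x.1 x.2) _ _)).
- by move=> x; exact: is_diff_mYZ.
- by [].
- by apply/funext => d; rewrite dotpNl -dotp_YZ.
Qed.

Lemma is_diff_H_S p : (forall s, 0 < mS p s) ->
  is_diff p (@H_S R S Y Z) (dotp (fun s _ _ => - (1 + ln (mS p s)))).
Proof.
move=> p0; apply: (is_diff_eq (is_diff_entropy (m := @mS R S Y Z) _ _)).
- by move=> x; exact: is_diff_mS.
- by [].
- by apply/funext => d; rewrite dotpNl -dotp_S.
Qed.

Lemma is_diff_H_Y p : (forall y, 0 < mY p y) ->
  is_diff p (@H_Y R S Y Z) (dotp (fun _ y _ => - (1 + ln (mY p y)))).
Proof.
move=> p0; apply: (is_diff_eq (is_diff_entropy (m := @mY R S Y Z) _ _)).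
- by move=> x; exact: is_diff_mY.
- by [].
- by apply/funext => d; rewrite dotpNl -dotp_Y.
Qed.

Lemma is_diff_H_Z p : (forall z, 0 < mZ p z) ->
  is_diff p (@H_Z R S Y Z) (dotp (fun _ _ z => - (1 + ln (mZ p z)))).
Proof.
move=> p0; apply: (is_diff_eq (is_diff_entropy (m := @mZ R S Y Z) _ _)).
- by move=> x; exact: is_diff_mZ.
- by [].
- by apply/funext => d; rewrite dotpNl -dotp_Z.
Qed.

Lemma is_diff_continuous (f : tensor R S Y Z -> R)
    (df : tensor R S Y Z -> tensor R S Y Z -> R) :
  (forall p, is_diff p f (df p)) -> continuous f.
Proof. by move=> h p; apply: differentiable_continuous; exact: ex_diff. Qed.

Lemma nonneg_near q : (forall s y z, 0 < ent q s y z) ->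
  \forall q' \near q, nonneg q'.
Proof.
move=> q0; have : \forall q' \near q, forall x : S * Y * Z,
    0 < ent q' x.1.1 x.1.2 x.2.
  refine (@filter_forall _ _
    (fun (x : S * Y * Z) q' => 0 < ent q' x.1.1 x.1.2 x.2)
    _ (nbhs_filter q) _) => x.
  have := @is_diff_continuous _ _ (fun p => is_diff_ent p x.1.1 x.1.2 x.2) q.
  move=> /cvgrPdist_lt/(_ _ (q0 x.1.1 x.1.2 x.2)); apply: filterS => q'.
  by rewrite ltr_distlC subrr => /andP[].
by apply: filterS => q' h s y z; exact/ltW/(h (s, y, z)).
Qed.

(** * Existence of optimal solutions *)

Lemma continuous_H_S_gYZ : continuous (@H_S_gYZ R S Y Z).
Proof.
have cSYZ : continuous (@H_SYZ R S Y Z).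
  apply: (@continuous_entropy _ _ _
    (fun p (x : S * Y * Z) => ent p x.1.1 x.1.2 x.2)) => x.
  exact: (is_diff_continuous (fun p => is_diff_ent p _ _ _)).
have cYZ : continuous (@H_YZ R S Y Z).
  apply: (@continuous_entropy _ _ _ (fun p (x : Y * Z) => mYZ p x.1 x.2)) => x.
  exact: (is_diff_continuous (fun p => is_diff_mYZ p _ _)).
by move=> p; exact: (continuousB (cSYZ p) (cYZ p)).
Qed.

Lemma closed_Delta p : closed (Delta p).
Proof.
rewrite (_ : Delta p =
  \bigcap_(x : S * Y) [set q | mSY q x.1 x.2 = mSY p x.1 x.2] `&`
  \bigcap_(x : S * Z) [set q | mSZ q x.1 x.2 = mSZ p x.1 x.2] `&`
  \bigcap_(x : S * Y * Z) [set q | 0 <= ent q x.1.1 x.1.2 x.2]).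
  apply: closedI; first apply: closedI; apply: closed_bigI => x _.
  - apply: (@closed_comp _ _ (fun q => mSY q x.1 x.2)
        [set t | t = mSY p x.1 x.2]);
      last exact: closed_eq.
    by move=> q _; exact: (is_diff_continuous (fun p => is_diff_mSY p _ _)).
  - apply: (@closed_comp _ _ (fun q => mSZ q x.1 x.2)
        [set t | t = mSZ p x.1 x.2]);
      last exact: closed_eq.
    by move=> q _; exact: (is_diff_continuous (fun p => is_diff_mSZ p _ _)).
  - apply: (@closed_comp _ _ (fun q => ent q x.1.1 x.1.2 x.2) [set t | 0 <= t]);
      last exact: closed_ge.
    by move=> q _; exact: (is_diff_continuous (fun p => is_diff_ent p _ _ _)).
apply/seteqP; split=> q.
  by move=> [h1 h2 h3]; split; [split|] => -[x ?] _ //=.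
move=> [[h1 h2] h3]; split.
- by move=> s y; exact: (h1 (s, y)).
- by move=> s z; exact: (h2 (s, z)).
- by move=> s y z; exact: (h3 (s, y, z)).
Qed.

(** Every entry of a point of [Delta p] lies between 0 and a marginal
    [mSY p s y], so [Delta p] is a closed part of a cube. *)
Lemma compact_Delta p : compact (Delta p).
Proof.
pose u := \sum_(x : S * Y) `|mSY p x.1 x.2|.
apply: (@subclosed_compact _ (Delta p)
  [set v : tensor R S Y Z | forall i, v ord0 i \in `[0, u]]).
- exact: closed_Delta.
- apply: (@rV_compact _ _ (fun=> `[0, u]%classic)) => _.
  exact: segment_compact.
- move=> q [qSY _ q0] i /=.
  rewrite -(enum_valK i); case: (enum_val i) => -[s y] z.
  rewrite in_itv/=; apply/andP; split; first exact: q0.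
  rewrite -/(ent q s y z) /u (bigD1 (s, y))//= -qSY.
  rewrite -[leLHS]addr0 lerD ?sumr_ge0// (le_trans _ (ler_norm _))//.
  rewrite /mSY (bigD1 z)//= lerDl; apply: sumr_ge0 => z' _; exact: q0.
Qed.

Lemma exists_optimal p : nonneg p -> exists q, optimal p q.
Proof.
move=> p0.
have [|||q] := @EVT_max_rV R _ (@H_S_gYZ R S Y Z) (Delta p).
- by exists p.
- exact: compact_Delta.
- by apply: continuous_subspaceT; exact: continuous_H_S_gYZ.
- rewrite inE => qD qmax; exists q; split=> // q' q'D.
  by apply: qmax; rewrite inE.
Qed.

(** * The maximal conditional entropy and the decomposition *)

(** The optimal value [M p] of the maximization of H(S | Y, Z) over
    [Delta p]. *)
Definition max_cond p : R := max_over (Delta p) (@H_S_gYZ R S Y Z).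

Lemma max_condE p q : optimal p q -> max_cond p = H_S_gYZ q.
Proof. by move=> [qD qmax]; exact: max_over_eq. Qed.

Lemma Delta_H_SY p q : Delta p q -> H_SY q = H_SY p.
Proof.
by move=> [h _ _]; congr (- _); apply: eq_bigr => x _; rewrite h.
Qed.

Lemma Delta_H_SZ p q : Delta p q -> H_SZ q = H_SZ p.
Proof.
by move=> [_ h _]; congr (- _); apply: eq_bigr => x _; rewrite h.
Qed.

Lemma Delta_H_S p q : Delta p q -> H_S q = H_S p.
Proof.
move=> [h _ _]; congr (- _); apply: eq_bigr => s _.
by rewrite (_ : mS q s = mS p s)//; apply: eq_bigr => y _; exact: h.
Qed.

Lemma Delta_H_Y p q : Delta p q -> H_Y q = H_Y p.
Proof.
move=> [h _ _]; congr (- _); apply: eq_bigr => y _.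
by rewrite (_ : mY q y = mY p y)//; apply: eq_bigr => s _; exact: h.
Qed.

Lemma Delta_H_Z p q : Delta p q -> H_Z q = H_Z p.
Proof.
move=> [_ h _]; congr (- _); apply: eq_bigr => z _.
by rewrite (_ : mZ q z = mZ p z)//; apply: eq_bigr => s _; exact: h.
Qed.

Lemma CI_max_cond p : nonneg p -> CI p = - H_S_gYZ p + max_cond p.
Proof.
move=> p0; have [q qo] := exists_optimal p0.
rewrite (max_condE qo) /CI; case: qo => qD qmax.
rewrite (min_over_eq qD) => [|q' q'D].
  by rewrite /MI_S_YZ (Delta_H_S qD); ring.
by rewrite /MI_S_YZ (Delta_H_S qD) (Delta_H_S q'D) lerB// qmax.
Qed.

Lemma SI_max_cond p : nonneg p ->
  SI p = (H_S p + H_Y p + H_Z p - H_SY p - H_SZ p) + max_cond p.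
Proof.
move=> p0; have [q qo] := exists_optimal p0.
have E q' : Delta p q' -> CoI q' =
    (H_S p + H_Y p + H_Z p - H_SY p - H_SZ p) + H_S_gYZ q'.
  move=> D; rewrite /CoI /MI_S_Y /MI_S_Y_gZ /H_S_gY /H_S_gZ.
  rewrite (Delta_H_S D) (Delta_H_Y D) (Delta_H_Z D) (Delta_H_SY D).
  by rewrite (Delta_H_SZ D); ring.
rewrite (max_condE qo) /SI; case: qo => qD qmax.
rewrite (max_over_eq qD) ?E// => q' q'D.
by rewrite !E// lerD2l qmax.
Qed.

Lemma UIy_max_cond p : nonneg p -> UIy p = (H_SZ p - H_Z p) - max_cond p.
Proof.
move=> p0; have [q qo] := exists_optimal p0.
have E q' : Delta p q' -> MI_S_Y_gZ q' = (H_SZ p - H_Z p) - H_S_gYZ q'.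
  by move=> D; rewrite -(Delta_H_Z D) -(Delta_H_SZ D).
rewrite (max_condE qo) /UIy; case: qo => qD qmax.
rewrite (min_over_eq qD) ?E// => q' q'D.
by rewrite !E// lerB// qmax.
Qed.

Lemma UIz_max_cond p : nonneg p -> UIz p = (H_SY p - H_Y p) - max_cond p.
Proof.
move=> p0; have [q qo] := exists_optimal p0.
have E q' : Delta p q' -> MI_S_Z_gY q' = (H_SY p - H_Y p) - H_S_gYZ q'.
  by move=> D; rewrite -(Delta_H_Y D) -(Delta_H_SY D).
rewrite (max_condE qo) /UIz; case: qo => qD qmax.
rewrite (min_over_eq qD) ?E// => q' q'D.
by rewrite !E// lerB// qmax.
Qed.

(** Concavity of [M] when [b = 1 - a]: a combination of points of [Delta p]
    and [Delta q] is feasible for the combination of [p] and [q]. *)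
Lemma max_cond_superadditive (a b : R) p q : 0 < a -> 0 < b ->
  nonneg p -> nonneg q ->
  a * max_cond p + b * max_cond q <= max_cond (a *: p + b *: q).
Proof.
move=> a0 b0 p0 q0.
have r0 : nonneg (a *: p + b *: q).
  by move=> s y z; rewrite entD !entZ addr_ge0// mulr_ge0// ltW.
have [p' p'o] := exists_optimal p0.
have [q' q'o] := exists_optimal q0.
have [r' r'o] := exists_optimal r0.
rewrite (max_condE p'o) (max_condE q'o) (max_condE r'o).
case: p'o => -[pSY pSZ p'0] _; case: q'o => -[qSY qSZ q'0] _.
apply: le_trans (H_S_gYZ_superadditive a0 b0 p'0 q'0) _.
apply: (proj2 r'o); split.
- have E p1 q1 s y :
      mSY (a *: p1 + b *: q1) s y = a * mSY p1 s y + b * mSY q1 s y.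
    rewrite /mSY !mulr_sumr -big_split; apply: eq_bigr => z _.
    by rewrite entD !entZ.
  by move=> s y; rewrite !E pSY qSY.
- have E p1 q1 s z :
      mSZ (a *: p1 + b *: q1) s z = a * mSZ p1 s z + b * mSZ q1 s z.
    rewrite /mSZ !mulr_sumr -big_split; apply: eq_bigr => y _.
    by rewrite entD !entZ.
  by move=> s z; rewrite !E pSZ qSZ.
- by move=> s y z; rewrite entD !entZ addr_ge0// mulr_ge0// ltW.
Qed.

(** * Lagrange multipliers as a supergradient *)

Section multipliers.
Variables (lambda : S -> Y -> R) (mu : S -> Z -> R).
(** The candidate for the gradient, or a supergradient, of [max_cond]. *)
Let G (s : S) (y : Y) (z : Z) : R := - (lambda s y + mu s z).

(** [G] is a function of (s, y) plus a function of (s, z), so its scalar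
    product with a tensor only sees the marginals fixed in [Delta p]. *)
Lemma dotp_Delta p q : Delta p q -> dotp G q = dotp G p.
Proof.
move=> [hSY hSZ _]; rewrite /G !dotpNl !dotpDl -!dotp_SY -!dotp_SZ.
congr (- (_ + _)); apply: eq_bigr => x _; first by rewrite hSY.
by rewrite hSZ.
Qed.

Lemma certified_H_S_gYZ q : nonneg q -> certifies q lambda mu ->
  H_S_gYZ q = dotp G q.
Proof.
move=> q0 [c _]; rewrite H_S_gYZ_eq_dotp// -dotpNl.
apply: eq_bigr => s _; apply: eq_bigr => y _; apply: eq_bigr => z _.
have := q0 s y z; rewrite le_eqVlt => /predU1P[<-|qs]; first by rewrite !mulr0.
by rewrite /G (proj2 (c y z (mYZ_gt0 q0 qs) s)).
Qed.

(** Gibbs' inequality on each slice, with the conditional distribution of [q]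
    if [mYZ q y z > 0] and with the distribution provided by the second
    clause of the certificate otherwise. *)
Lemma H_S_gYZ_le_multipliers q q' : nonneg q -> certifies q lambda mu ->
  nonneg q' -> H_S_gYZ q' <= dotp G q'.
Proof.
move=> q0 [c1 c2] q'0; rewrite dotpNl; apply: H_S_gYZ_le_dotp => // y z.
have := mYZ_ge0 y z q0; rewrite le_eqVlt => /predU1P[m0|m0].
  have [rho [r0 r1 rL]] := c2 y z (esym m0).
  by exists rho; split=> [s||s _]; [exact/ltW | rewrite r1 | split].
exists (fun s => ent q s y z / mYZ q y z); split => [s||s _].
- by rewrite divr_ge0// ltW.
- exact: sum_cond_le1.
- by have [qs ->] := c1 y z m0 s; rewrite divr_gt0.
Qed.

Lemma max_cond_le_multipliers q p' : nonneg q -> certifies q lambda mu ->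
  nonneg p' -> max_cond p' <= dotp G p'.
Proof.
move=> q0 c p'0; have [r ro] := exists_optimal p'0.
rewrite (max_condE ro) -(dotp_Delta (proj1 ro)).
by apply: H_S_gYZ_le_multipliers c _ => //; case: ro => -[].
Qed.

Lemma max_cond_multipliers p q : optimal p q -> certifies q lambda mu ->
  max_cond p = dotp G p.
Proof.
move=> qo c; rewrite (max_condE qo) certified_H_S_gYZ//; last first.
  by case: qo => -[].
by rewrite (dotp_Delta (proj1 qo)).
Qed.

Lemma is_diff_H_S_gYZ q : (forall s y z, 0 < ent q s y z) ->
  (forall y z, 0 < mYZ q y z) ->
  is_diff q (@H_S_gYZ R S Y Z)
    (dotp (fun s y z => - ln (ent q s y z / mYZ q y z))).
Proof.
move=> q0 m0.
apply: (is_diff_eq (is_diffB (is_diff_H_SYZ q0) (is_diff_H_YZ m0))).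
apply/funext => d; rewrite -[LHS]/(dotp _ d - dotp _ d) -dotpNl -dotpDl.
by apply: eq_dotp => s y z; rewrite ln_div ?posrE//; ring.
Qed.

(** The lower function of the squeeze is the conditional entropy of
    [p' + (q - p)], which is feasible for [p'] near [p]; the upper one is
    [dotp G]. *)
Lemma is_diff_max_cond p q : (0 < #|S|)%N -> (forall s y z, 0 < ent p s y z) ->
  optimal p q -> certifies q lambda mu -> (forall s y z, 0 < ent q s y z) ->
  is_diff p max_cond (dotp G).
Proof.
move=> /card_gt0P[s0 _] p0 qo c q0.
have q0' : nonneg q by move=> s y z; exact/ltW.
have m0 y z : 0 < mYZ q y z by apply: (mYZ_gt0 q0' (q0 s0 y z)).
have dh : is_diff q (@H_S_gYZ R S Y Z) (dotp G).
  apply: (is_diff_eq (is_diff_H_S_gYZ q0 m0)); apply/funext => d.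
  by apply: eq_dotp => s y z; rewrite /G (proj2 (proj1 c y z (m0 y z) s)).
have dsh : is_diff p (fun p' => p' + (q - p)) id.
  apply: (is_diff_eq (is_diffD (is_diff_id p) (is_diff_cst (q - p) p))).
  by rewrite addr0.
have pq : p + (q - p) = q by rewrite addrC subrK.
have {}dh : is_diff (p + (q - p)) (@H_S_gYZ R S Y Z) (dotp G) by rewrite pq.
have dl := is_diff_comp dsh dh.
apply: (is_diff_squeeze dl (is_diff_dotp p G)).
- by rewrite /= pq (max_condE qo).
- by rewrite (max_cond_multipliers qo c).
- have Np : \forall p' \near p, nonneg p' by exact: nonneg_near.
  have Nq : \forall p' \near p, nonneg (p' + (q - p)).
    have := differentiable_continuous (ex_diff (is_diff_def := dsh)).
    apply; rewrite pq; exact: nonneg_near.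
  near=> p'.
  have p'0 : nonneg p' by near: p'.
  rewrite (max_cond_le_multipliers q0' c p'0) andbT /=.
  have [r ro] := exists_optimal p'0.
  rewrite (max_condE ro); apply: (proj2 ro); case: qo => -[qSY qSZ _] _.
  split; last by near: p'.
  + move=> s y; rewrite /mSY; under eq_bigr do rewrite entD entD entN.
    by rewrite big_split sumrB /= -!/(mSY _ s y) qSY subrr addr0.
  + move=> s z; rewrite /mSZ; under eq_bigr do rewrite entD entD entN.
    by rewrite big_split sumrB /= -!/(mSZ _ s z) qSZ subrr addr0.
Unshelve. all: by end_near. Qed.

(** By concavity, the difference quotients along [d] do not decrease as [t]
    decreases to 0 and they stay below [dotp G d]. *)
Lemma supergradient_max_cond p q : (forall s y z, 0 < ent p s y z) ->
  optimal p q -> certifies q lambda mu -> local_supergradient max_cond p G.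
Proof.
move=> p0 qo c d.
have q0 : nonneg q by case: qo => -[].
pose slope (t : R) := (max_cond (p + t *: d) - max_cond p) / t.
have near_nonneg : \forall t \near 0^'+, nonneg (p + t *: d).
  exact: (@cvg_line p d _ (nonneg_near p0)).
have near_nonneg_le : \forall t \near 0^'+, forall t', 0 < t' <= t ->
    nonneg (p + t' *: d).
  near=> t => t' /andP[t'0 t't] s y z.
  have tn : nonneg (p + t *: d) by near: t.
  have t0 : 0 < t by exact: lt_le_trans t't.
  have := tn s y z; rewrite !entD !entZ => h.
  (* [t (p + t' d) = (t - t') p + t' (p + t d)] *)
  rewrite -(pmulr_rge0 _ t0).
  rewrite mulrDr [X in _ + X](_ : _ = t' * (t * ent d s y z)); last by ring.
  have := p0 s y z; nra.
have slope_le t : 0 < t -> nonneg (p + t *: d) -> slope t <= dotp G d.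
  move=> t0 tn.
  rewrite /slope ler_pdivrMr// (max_cond_multipliers qo c) lerBlDl.
  by rewrite (le_trans (max_cond_le_multipliers q0 c tn))// dotpDr dotpZr mulrC.
have slope_mono t t' : 0 < t' -> t' <= t -> nonneg (p + t *: d) ->
    slope t <= slope t'.
  move=> t'0; rewrite le_eqVlt => /predU1P[->//|t't] tn.
  have t0 : 0 < t by exact: lt_trans t't.
  (* [p + t' d] is the convex combination of [p] and [p + t d] with weight
     [t' / t] on the latter. *)
  have a0 : 0 < 1 - t' / t by rewrite subr_gt0 ltr_pdivrMr// mul1r.
  have b0 : 0 < t' / t by rewrite divr_gt0.
  have pn : nonneg p by move=> s y z; exact/ltW.
  have := max_cond_superadditive a0 b0 pn tn.
  rewrite scalerDr addrA -scalerDl subrK scale1r scalerA divfK ?gt_eqF// => h.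
  rewrite /slope ler_pdivlMr// mulrAC -mulrA.
  set u := t' / t in h *; lra.
have cvg_slope : cvg (slope @ 0^'+).
  apply: nonincreasing_at_right_is_cvgr.
  - near=> x => t' t; rewrite !in_itv/= => /andP[t'0 t'x] /andP[t0 tx] t't.
    apply: slope_mono => //.
    have H : forall t', 0 < t' <= x -> nonneg (p + t' *: d) by near: x.
    by apply: H; rewrite t0 ltW.
  - near=> x; exists (dotp G d) => _ [t + <-].
    rewrite /= in_itv/= => /andP[t0 tx].
    have H : forall t', 0 < t' <= x -> nonneg (p + t' *: d) by near: x.
    by apply: slope_le => //; apply: H; rewrite t0 ltW.
exists (lim (slope @ 0^'+)) => //.
apply: limr_le => //; near=> t; apply: slope_le.
- by near: t; exact: nbhs_right_gt.
- by near: t.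
Unshelve. all: by end_near. Qed.

End multipliers.

(** * Sums with a differentiable function *)

Lemma differentiable_with_partials_of_is_diff f p g :
  is_diff p f (dotp g) -> differentiable_with_partials f p g.
Proof.
move=> df; have dp : differentiable f p by exact: ex_diff.
split=> // s y z; rewrite deriveE// (diff_val (f := f)).
exact: dotp_basis_vec.
Qed.

Lemma is_dir_derivative_add p d (f F M : tensor R S Y Z -> R) (a b : R) :
  is_dir_derivative F p d a -> is_dir_derivative M p d b ->
  (\forall q \near p, f q = F q + M q) -> is_dir_derivative f p d (a + b).
Proof.
move=> Fa Mb fFM; have fp := nbhs_singleton fFM.
apply: cvg_trans (cvgD Fa Mb); apply: near_eq_cvg.
have ft : \forall t \near 0^'+,
    f (p + t *: d) = F (p + t *: d) + M (p + t *: d).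
  exact: (@cvg_line p d _ fFM).
near=> t => /=; rewrite (near ft t)// fp.
rewrite -[LHS]/((F (p + t *: d) - F p) / t + (M (p + t *: d) - M p) / t).
by rewrite -mulrDl; congr (_ / _); ring.
Unshelve. all: by end_near. Qed.

Lemma is_dir_derivative_opp p d f (a : R) :
  is_dir_derivative f p d a -> is_dir_derivative (fun q => - f q) p d (- a).
Proof.
move=> fa; apply: cvg_trans (cvgN fa); apply: near_eq_cvg.
by apply: nearW => t /=; rewrite -mulNr opprB opprK addrC.
Qed.

Lemma supergradient_add p f F M g g1 g2 :
  is_diff p F (dotp g1) -> local_supergradient M p g2 ->
  (\forall q \near p, f q = F q + M q) ->
  (forall s y z, g s y z = g1 s y z + g2 s y z) ->
  local_supergradient f p g.
Proof.
move=> dF dM fE gE d; have [l Ml lg] := dM d.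
exists (dotp g1 d + l).
  exact: is_dir_derivative_add (is_diff_dir dF) Ml fE.
by rewrite (eq_dotp _ gE) dotpDl lerD2l.
Qed.

Lemma subgradient_sub p f F M g g1 g2 :
  is_diff p F (dotp g1) -> local_supergradient M p g2 ->
  (\forall q \near p, f q = F q - M q) ->
  (forall s y z, g s y z = g1 s y z - g2 s y z) ->
  local_subgradient f p g.
Proof.
move=> dF dM fE gE d; have [l Ml lg] := dM d.
exists (dotp g1 d - l).
  exact: is_dir_derivative_add (is_diff_dir dF) (is_dir_derivative_opp Ml) fE.
by rewrite (eq_dotp _ gE) dotpDl dotpNl lerB.
Qed.

Lemma partials_add p f F M g g1 g2 :
  is_diff p F (dotp g1) -> is_diff p M (dotp g2) ->
  (\forall q \near p, f q = F q + M q) ->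
  (forall s y z, g s y z = g1 s y z + g2 s y z) ->
  differentiable_with_partials f p g.
Proof.
move=> dF dM fE gE; apply: differentiable_with_partials_of_is_diff.
rewrite (_ : dotp g = dotp g1 + dotp g2); last first.
  by apply/funext => d; rewrite (eq_dotp _ gE) dotpDl.
apply: (is_diff_near_eq _ (is_diffD dF dM)).
by apply: filterS fE => q ->.
Qed.

Lemma partials_sub p f F M g g1 g2 :
  is_diff p F (dotp g1) -> is_diff p M (dotp g2) ->
  (\forall q \near p, f q = F q - M q) ->
  (forall s y z, g s y z = g1 s y z - g2 s y z) ->
  differentiable_with_partials f p g.
Proof.
move=> dF dM fE gE; apply: differentiable_with_partials_of_is_diff.
rewrite (_ : dotp g = dotp g1 - dotp g2); last first.
  by apply/funext => d; rewrite (eq_dotp _ gE) dotpDl dotpNl.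
apply: (is_diff_near_eq _ (is_diffB dF dM)).
by apply: filterS fE => q ->.
Qed.

End tensors.

(** * Partial derivatives and supergradients of the decomposition *)

Theorem theorem4 (R : realType) (S Y Z : finType)
  (S_gt0 : (0 < #|S|)%N) (Y_gt0 : (0 < #|Y|)%N) (Z_gt0 : (0 < #|Z|)%N)
  (p : tensor R S Y Z)
  (p_sum : \sum_(s : S) \sum_(y : Y) \sum_(z : Z) ent p s y z = 1)
  (p_gt0 : forall s y z, 0 < ent p s y z)
  (q : tensor R S Y Z) (q_opt : optimal p q)
  (lambda : S -> Y -> R) (mu : S -> Z -> R)
  (cert : certifies q lambda mu) :
  ((forall s y z, 0 < ent q s y z) ->
     [/\ differentiable_with_partials (@CI R S Y Z) p (g_CI p lambda mu),
         differentiable_with_partials (@SI R S Y Z) p (g_SI p lambda mu),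
         differentiable_with_partials (@UIy R S Y Z) p (g_UIy p lambda mu) &
         differentiable_with_partials (@UIz R S Y Z) p (g_UIz p lambda mu)])
  /\
  [/\ local_supergradient (@CI R S Y Z) p (g_CI p lambda mu),
      local_supergradient (@SI R S Y Z) p (g_SI p lambda mu),
      local_subgradient (@UIy R S Y Z) p (g_UIy p lambda mu) &
      local_subgradient (@UIz R S Y Z) p (g_UIz p lambda mu)].
Proof.
have pSY s y : 0 < mSY p s y by exact: sum_fin_gt0.
have pSZ s z : 0 < mSZ p s z by exact: sum_fin_gt0.
have pYZ y z : 0 < mYZ p y z by exact: sum_fin_gt0.
have pS s : 0 < mS p s by apply: sum_fin_gt0 => // y; exact: sum_fin_gt0.
have pY y : 0 < mY p y by apply: sum_fin_gt0 => // s; exact: sum_fin_gt0.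
have pZ z : 0 < mZ p z by apply: sum_fin_gt0 => // s; exact: sum_fin_gt0.
have dC : is_diff p (fun q => - H_S_gYZ q)
    (dotp (fun s y z => ln (ent p s y z / mYZ p y z))).
  apply: (is_diff_eq (is_diffN (is_diff_H_S_gYZ p_gt0 pYZ))).
  by apply/funext => d; rewrite -[LHS]/(- dotp _ d) dotpNl opprK.
have dS : is_diff p (fun q => H_S q + H_Y q + H_Z q - H_SY q - H_SZ q)
    (dotp (fun s y z => - 1 +
       ln ((mSY p s y * mSZ p s z) / (mS p s * mY p y * mZ p z)))).
  apply: (is_diff_eq (is_diffB (is_diffB (is_diffD (is_diffD (is_diff_H_S pS)
    (is_diff_H_Y pY)) (is_diff_H_Z pZ)) (is_diff_H_SY pSY))
    (is_diff_H_SZ pSZ))).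
  apply/funext => d.
  rewrite -[LHS]/(dotp _ d + dotp _ d + dotp _ d - dotp _ d - dotp _ d).
  rewrite -!dotpNl -!dotpDl; apply: eq_dotp => s y z.
  by rewrite ln_div ?posrE ?mulr_gt0// !lnM ?posrE ?mulr_gt0//; ring.
have dy : is_diff p (fun q => H_SZ q - H_Z q)
    (dotp (fun s y z => ln (mZ p z / mSZ p s z))).
  apply: (is_diff_eq (is_diffB (is_diff_H_SZ pSZ) (is_diff_H_Z pZ))).
  apply/funext => d; rewrite -[LHS]/(dotp _ d - dotp _ d).
  rewrite -dotpNl -dotpDl; apply: eq_dotp => s y z.
  by rewrite ln_div ?posrE//; ring.
have dz : is_diff p (fun q => H_SY q - H_Y q)
    (dotp (fun s y z => ln (mY p y / mSY p s y))).
  apply: (is_diff_eq (is_diffB (is_diff_H_SY pSY) (is_diff_H_Y pY))).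
  apply/funext => d; rewrite -[LHS]/(dotp _ d - dotp _ d).
  rewrite -dotpNl -dotpDl; apply: eq_dotp => s y z.
  by rewrite ln_div ?posrE//; ring.
have nn := nonneg_near p_gt0.
have eC : \forall q \near p, CI q = - H_S_gYZ q + max_cond q.
  by apply: filterS nn => q' /CI_max_cond.
have eS : \forall q \near p,
    SI q = (H_S q + H_Y q + H_Z q - H_SY q - H_SZ q) + max_cond q.
  by apply: filterS nn => q' /SI_max_cond.
have ey : \forall q \near p, UIy q = (H_SZ q - H_Z q) - max_cond q.
  by apply: filterS nn => q' /UIy_max_cond.
have ez : \forall q \near p, UIz q = (H_SY q - H_Y q) - max_cond q.
  by apply: filterS nn => q' /UIz_max_cond.
split.
  move=> q0; have dM := is_diff_max_cond S_gt0 p_gt0 q_opt cert q0.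
  split; [apply: (partials_add dC dM eC) | apply: (partials_add dS dM eS)
    | apply: (partials_sub dy dM ey) | apply: (partials_sub dz dM ez)];
    by move=> s y z; rewrite /g_CI /g_SI /g_UIy /g_UIz; ring.
have dM := supergradient_max_cond p_gt0 q_opt cert.
split; [apply: (supergradient_add dC dM eC)
  | apply: (supergradient_add dS dM eS)
  | apply: (subgradient_sub dy dM ey) | apply: (subgradient_sub dz dM ez)];
  by move=> s y z; rewrite /g_CI /g_SI /g_UIy /g_UIz; ring.
Qed.
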